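(* Let $n>2$, $R>0$, and let $u$ be a solution on $B_R\subset\mathbb{R}^n$ of $$\sum_{i=1}^n\arctan\lambda_i=\Theta(x,u,Du)\in\left(-\tfrac{n\pi}{2},\tfrac{n\pi}{2}\right),$$ where $\lambda_1,\dots,\lambda_n$ are the eigenvalues of $D^2u$, with $\|D^2u\|_{L^\infty(B_R)}<\infty$. Let $f(\lambda)=\sum_{j=1}^n\arctan(\lambda_j)$ be defined on $$\left\{\lambda\in\mathbb{R}^n \;:\; \sum_{j=1}^n\arctan\lambda_j\ge (n-2)\tfrac{\pi}{2},\ |\lambda_j|\le\|D^2u\|_{L^\infty(B_R)}\text{ for all } j\right\}.$$ Then there exists a constant $A$ depending on $\|D^2u\|_{L^\infty(B_R)}$ and $n$ such that $-e^{-Af(\lambda)}$ is a concave function of $\lambda$ on this set.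
   Context: $B_R$ is the ball of radius $R$ centered at the origin. $\|D^2u\|_{L^\infty(B_R)}$ is the supremum over $B_R$ of the largest absolute value of an eigenvalue of $D^2u$. *)

(* Defs.v *)
From HB Require Import structures.
From mathcomp Require Import all_boot all_order all_algebra.
From mathcomp Require Import all_classical all_reals all_analysis.

Set Implicit Arguments.
Unset Strict Implicit.
Unset Printing Implicit Defensive.

Import Order.TTheory GRing.Theory Num.Theory.
Import numFieldNormedType.Exports.

Local Open Scope classical_set_scope.
Local Open Scope ring_scope.

(* The library norm on ['rV[R]_n] is the sup norm, so Euclidean balls are
   written out. *)
Definition eball (R : realType) (n : nat) (r : R) : set 'rV[R]_n :=
  [set x | \sum_(i < n) x 0 i ^+ 2 < r ^+ 2].

Definition partial (R : realType) (n : nat) (i : 'I_n) (u : 'rV[R]_n -> R) :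
  'rV[R]_n -> R := 'D_(delta_mx 0 i) u.

Definition gradient (R : realType) (n : nat) (u : 'rV[R]_n -> R)
  (x : 'rV[R]_n) : 'rV[R]_n := \row_(i < n) partial i u x.

Definition hessian (R : realType) (n : nat) (u : 'rV[R]_n -> R)
  (x : 'rV[R]_n) : 'M[R]_n :=
  \matrix_(i < n, j < n) partial j (partial i u) x.

(* Meant for an open set [Om]: derivatives and continuity at a point of [Om]
   then only see the values of [u] on [Om]. *)
Definition C2_on (R : realType) (n : nat) (Om : set 'rV[R]_n)
    (u : 'rV[R]_n -> R) : Prop :=
  forall x, Om x ->
    [/\ {for x, continuous u},
        forall i : 'I_n,
          derivable u x (delta_mx 0 i) /\ {for x, continuous (partial i u)}
      & forall i j : 'I_n,
          derivable (partial i u) x (delta_mx 0 j) /\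
          {for x, continuous (partial j (partial i u))} ].

(* [lam] lists the eigenvalues of [M] with algebraic multiplicity. *)
Definition eigenvalues_of (R : realType) (n : nat) (M : 'M[R]_n)
  (lam : 'rV[R]_n) : Prop :=
  char_poly M = \prod_(i < n) ('X - (lam 0 i)%:P).

Definition phase (R : realType) (n : nat) (lam : 'rV[R]_n) : R :=
  \sum_(j < n) atan (lam 0 j).

(* Classical solutions of
     sum_i arctan lambda_i(D^2 u) = Theta(x, u, Du)  in ]-n pi/2, n pi/2[. *)
Definition lagrangian_solution (R : realType) (n : nat) (Om : set 'rV[R]_n)
    (Theta : 'rV[R]_n -> R -> 'rV[R]_n -> R) (u : 'rV[R]_n -> R) : Prop :=
  C2_on Om u /\
  forall x, Om x ->
    - (n%:R * pi / 2) < Theta x (u x) (gradient u x) < n%:R * pi / 2 /\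
    exists lam : 'rV[R]_n, eigenvalues_of (hessian u x) lam /\
      phase lam = Theta x (u x) (gradient u x).

Definition hessian_norm (R : realType) (n : nat) (Om : set 'rV[R]_n)
    (u : 'rV[R]_n -> R) : \bar R :=
  ereal_sup [set ereal_sup [set `|a|%:E | a in [set a | eigenvalue (hessian u x) a]]
            | x in Om].

Definition phase_domain (R : realType) (n : nat) (M : R) : set 'rV[R]_n :=
  [set lam | (n%:R - 2) * (pi / 2) <= phase lam /\
             forall j : 'I_n, `|lam 0 j| <= M].

(* [convex_function] does not itself require its domain to be convex. *)
Definition concave_on (R : realType) (n : nat) (D : set 'rV[R]_n)
    (g : 'rV[R]_n -> R) : Prop :=
  convex_set D /\ convex_function D (fun lam => - g lam).

(* Main.v *)
(** Put [alpha_i = pi/2 - arctan lambda_i], an angle in ]0, pi[ with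
    [cot alpha_i = lambda_i]; the domain is [sum_i alpha_i <= pi] inside a box.
    The addition formula [cot (a + b) = (x y - 1) / (x + y)] is increasing and
    jointly concave in [x = cot a], [y = cot b] on [x + y > 0], so
    [cot (sum_i alpha_i)] is concave in [lambda], but it tends to [-oo] at the
    critical phase.  Since [n > 2] and [lambda] lies in a box, the first two
    angles have a sum bounded away from [pi], which makes the concavity of
    [cot (alpha_1 + alpha_2)] strong enough to survive a small shift
    [cot (alpha_1 + alpha_2 - delta)], with [cot delta = k] large.  Adding the
    other angles one at a time, [z = cot (sum_i alpha_i - delta)] is concave and
    is at least [- k] exactly on the domain, which is therefore convex.  Up to a
    positive factor [expR (- A f)] is [expR (- A * atan z)], a decreasing
    function of [z] that is convex on [z >= - A / 2]; hence [A = 2 k]. *)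

Require Import Defs.
From HB Require Import structures.
From mathcomp Require Import all_boot all_order all_algebra.
From mathcomp Require Import all_classical all_reals all_analysis.
From mathcomp Require Import ring lra.

Set Implicit Arguments.
Unset Strict Implicit.
Unset Printing Implicit Defensive.

Import Order.TTheory GRing.Theory Num.Theory.
Import numFieldNormedType.Exports.

Local Open Scope classical_set_scope.
Local Open Scope ring_scope.

(** * Addition of cotangents and its concavity *)

(* [cot (a + b)] for [x = cot a], [y = cot b]. *)
Definition cotD (R : realType) (x y : R) : R := (x * y - 1) / (x + y).

Lemma atan_add_gt0 (R : realType) (x y : R) :
  (0 < atan x + atan y) = (0 < x + y).
Proof.
rewrite -!ltrBlDr !sub0r -atanN; apply/idP/idP; last exact: lt_atan.
by apply: contraTT; rewrite -!leNgt => /le_atan.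
Qed.

(** For [x = cot a], [y = cot b], positivity of [x + y] means [a + b < pi], so the addition formula
    stays on one branch. *)
Lemma atan_cotD (R : realType) (x y : R) :
  0 < x + y -> atan x + atan y = pi / 2 + atan (cotD x y).
Proof.
move=> xy0; have axy : 0 < atan x + atan y by rewrite atan_add_gt0.
have cos_neq0 z : cos (atan z) != 0 :> R.
  by rewrite gt_eqF// cos_gt0_pihalf// atan_gtNpi2 atan_ltpi2.
have sinE z : sin (atan z) = z * cos (atan z) :> R.
  by rewrite -{2}[z]atanK /tan divfK.
suff -> : cotD x y = tan (atan x + atan y - pi / 2).
  rewrite tanK ?subrKC ?[_ + (_ - _)]addrC ?subrK// in_itv/=.
  by have := atan_ltpi2 x; have := atan_ltpi2 y => *; apply/andP; split; lra.
rewrite /tan /cotD sinB cosB cos_pihalf sin_pihalf !mulr0 !mulr1 sub0r add0r.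
rewrite sinD cosD !sinE; have := cos_neq0 x; have := cos_neq0 y.
move=> cy cx; field; rewrite (gt_eqF xy0) andbT.
have -> : x * cos (atan x) * cos (atan y) + cos (atan x) * (y * cos (atan y))
  = (x + y) * (cos (atan x) * cos (atan y)) by ring.
by rewrite !mulf_neq0// gt_eqF.
Qed.

(** The gap is kept exact: its size, not only its sign, later absorbs the loss caused by the
    shift. *)
Lemma quad_over_lin_gap (R : realType) (s t a0 a1 p0 p1 : R) :
  s + t = 1 -> 0 < p0 -> 0 < p1 -> 0 < s * p0 + t * p1 ->
  s * ((a0 ^+ 2 + 1) / p0) + t * ((a1 ^+ 2 + 1) / p1)
    - ((s * a0 + t * a1) ^+ 2 + 1) / (s * p0 + t * p1)
  = s * t * ((a0 * p1 - a1 * p0) ^+ 2 + (p0 - p1) ^+ 2)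
      / (p0 * p1 * (s * p0 + t * p1)).
Proof.
move=> st p00 p10; have -> : t = 1 - s by lra.
by move=> pm0; field; rewrite !gt_eqF.
Qed.

Lemma cotDE (R : realType) (x y : R) :
  0 < x + y -> cotD x y = y - (y ^+ 2 + 1) / (x + y).
Proof. by move=> xy0; rewrite /cotD; field; rewrite gt_eqF. Qed.

Lemma conv_gt0 (R : realType) (s t x y : R) :
  0 <= s -> 0 <= t -> s + t = 1 -> 0 < x -> 0 < y -> 0 < s * x + t * y.
Proof. by move=> s0 t0 st x0 y0; have [?|?] := ltP 0 s; nra. Qed.

Lemma conv_norm_le (R : realType) (s t M x y : R) :
  0 <= s -> 0 <= t -> s + t = 1 -> `|x| <= M -> `|y| <= M ->
  `|s * x + t * y| <= M.
Proof.
move=> s0 t0 st; rewrite !ler_norml => /andP[? ?] /andP[? ?].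
by apply/andP; split; nra.
Qed.

(** By [cotDE], [cotD] is linear minus quadratic-over-linear. Along a chain [x] is itself concave in
    the data, hence only bounded below by the mean. *)
Lemma cotD_concave (R : realType) (s t x0 x1 x y0 y1 : R) :
  0 <= s -> 0 <= t -> s + t = 1 -> 0 < x0 + y0 -> 0 < x1 + y1 ->
  s * x0 + t * x1 <= x ->
  0 < x + (s * y0 + t * y1) /\
  s * cotD x0 y0 + t * cotD x1 y1 <= cotD x (s * y0 + t * y1).
Proof.
move=> s0 t0 st p00 p10 xle.
set p0 := x0 + y0 in p00 *; set p1 := x1 + y1 in p10 *.
have pm0 : 0 < s * p0 + t * p1 by exact: conv_gt0.
have pm : s * p0 + t * p1 <= x + (s * y0 + t * y1) by rewrite /p0 /p1; lra.
have px0 := lt_le_trans pm0 pm; split => //.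
rewrite !cotDE// -/p0 -/p1.
have gap := quad_over_lin_gap y0 y1 st p00 p10 pm0.
have gap0 : 0 <= s * t * ((y0 * p1 - y1 * p0) ^+ 2 + (p0 - p1) ^+ 2)
      / (p0 * p1 * (s * p0 + t * p1)).
  have := ltW p00; have := ltW p10; have := ltW pm0 => *.
  by rewrite divr_ge0// !mulr_ge0// addr_ge0// sqr_ge0.
have : ((s * y0 + t * y1) ^+ 2 + 1) / (x + (s * y0 + t * y1)) <=
       ((s * y0 + t * y1) ^+ 2 + 1) / (s * p0 + t * p1).
  by rewrite ler_pM2l ?lef_pV2 ?posrE// ltr_wpDl ?sqr_ge0.
by rewrite -gap in gap0; lra.
Qed.

(** Every summand is negative, so the lower bound on the full sum passes to all initial sums and
    keeps each [cotD] on its domain. *)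
Lemma atan_chain_concave (R : realType) (n : nat) (s t x0 x1 x : R)
    (a0 a1 : 'I_n -> R) :
  0 <= s -> 0 <= t -> s + t = 1 -> s * x0 + t * x1 <= x ->
  - (pi / 2) < atan x0 + \sum_(i < n) (atan (a0 i) - pi / 2) ->
  - (pi / 2) < atan x1 + \sum_(i < n) (atan (a1 i) - pi / 2) ->
  exists z0 z1 z, [/\ atan x0 + \sum_(i < n) (atan (a0 i) - pi / 2) = atan z0,
    atan x1 + \sum_(i < n) (atan (a1 i) - pi / 2) = atan z1,
    atan x + \sum_(i < n) (atan (s * a0 i + t * a1 i) - pi / 2) = atan z
    & s * z0 + t * z1 <= z].
Proof.
move=> s0 t0 st xle; elim: n a0 a1 => [|n IHn] a0 a1.
  by rewrite !big_ord0 !addr0 => _ _; exists x0, x1, x.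
rewrite !big_ord_recr/= => h0 h1.
have l0 := atan_ltpi2 (a0 ord_max); have l1 := atan_ltpi2 (a1 ord_max).
have [||z0 [z1 [z [e0 e1 e zle]]]] := IHn (fun i => a0 (widen_ord (leqnSn n) i))
   (fun i => a1 (widen_ord (leqnSn n) i)).
- by move: h0; set S := \sum_(i < n) _; lra.
- by move: h1; set S := \sum_(i < n) _; lra.
rewrite !addrA e0 e1 e in h0 h1 *.
have p0 : 0 < z0 + a0 ord_max by rewrite -atan_add_gt0; lra.
have p1 : 0 < z1 + a1 ord_max by rewrite -atan_add_gt0; lra.
have [pm cle] := cotD_concave s0 t0 st p0 p1 zle.
exists (cotD z0 (a0 ord_max)), (cotD z1 (a1 ord_max)).
exists (cotD z (s * a0 ord_max + t * a1 ord_max)).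
have E y b : 0 < y + b -> atan y + atan b - pi / 2 = atan (cotD y b) :> R.
  by move=> /atan_cotD ->; lra.
by split => //; exact: E.
Qed.

(** * The shifted cotangent of the first two angles *)

(* A lower bound for the cotangent [k] of the shift: [M / 2] keeps [k] above
   [cotD x y] on the box, and the cubic term pays for the square of the variation
   of [cotD] in [shifted_cotD_concave]. *)
Definition slack (R : realType) (M : R) : R :=
  1 + `|M| / 2 + 9 / 2 * `|M| ^+ 3 * (1 + M ^+ 2) ^+ 2.

Lemma slack_gt0 (R : realType) (M : R) : 0 < slack M.
Proof.
rewrite /slack -addrA ltr_pwDl// addr_ge0//.
by rewrite !mulr_ge0 ?exprn_ge0 ?addr_ge0 ?sqr_ge0.
Qed.

Lemma cotD_le (R : realType) (M x y : R) :
  `|x| <= M -> `|y| <= M -> 0 < x + y -> cotD x y <= M / 2.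
Proof.
rewrite !ler_norml => /andP[? xM] /andP[? yM] xy0.
have := sqr_ge0 (x - y).
have : 0 <= (x + y) * (2 * M - (x + y)) by apply: mulr_ge0; lra.
by rewrite /cotD ler_pdivrMr//; lra.
Qed.

(** Combine [1 <= x * y + M * (x + y)] with [4 * x * y <= (x + y) ^+ 2 <= 2 * M * (x + y)]. *)
Lemma add_ge_of_cotD (R : realType) (M x y : R) :
  `|x| <= M -> `|y| <= M -> 0 < x + y -> - M <= cotD x y ->
  2 <= 3 * M * (x + y).
Proof.
rewrite !ler_norml => /andP[? xM] /andP[? yM] xy0.
have := sqr_ge0 (x - y).
have : 0 <= (x + y) * (2 * M - (x + y)) by apply: mulr_ge0; lra.
by rewrite /cotD ler_pdivlMr//; lra.
Qed.

(* [- cotD k (- g)] is [cot (c - delta)] for [g = cot c], [k = cot delta]; as a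
   function of [g] it is [- k + (k ^+ 2 + 1) / (k - g)], so the claim is that
   [1 / (k - cotD x y)] is concave: the convexity gap of [k - cotD x y] dominates
   the gap between arithmetic and harmonic means. *)
Lemma shifted_cotD_concave (R : realType) (s t M k x0 x1 y0 y1 : R)
    (x := s * x0 + t * x1) (y := s * y0 + t * y1) :
  0 <= s -> 0 <= t -> s + t = 1 -> slack M <= k ->
  `|x0| <= M -> `|x1| <= M -> `|y0| <= M -> `|y1| <= M ->
  0 < x0 + y0 -> 0 < x1 + y1 -> - M <= cotD x0 y0 -> - M <= cotD x1 y1 ->
  s * - cotD k (- cotD x0 y0) + t * - cotD k (- cotD x1 y1)
    <= - cotD k (- cotD x y).
Proof.
move=> s0 t0 st kM x0M x1M y0M y1M p00 p10 g0M g1M.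
have M0 : 0 <= M by exact: le_trans x0M.
have xM : `|x| <= M by exact: conv_norm_le.
have yM : `|y| <= M by exact: conv_norm_le.
have pm0 : 0 < x + y.
  by have := conv_gt0 s0 t0 st p00 p10; rewrite /x /y; lra.
have g0 := cotD_le x0M y0M p00; have g1 := cotD_le x1M y1M p10.
have gm := cotD_le xM yM pm0.
have p0M := add_ge_of_cotD x0M y0M p00 g0M.
have p1M := add_ge_of_cotD x1M y1M p10 g1M.
set G0 := cotD x0 y0 in g0 g0M *; set G1 := cotD x1 y1 in g1 g1M *.
set G := cotD x y in gm *.
rewrite /slack (ger0_norm M0) in kM.
set K := 9 / 2 * M ^+ 3 * (1 + M ^+ 2) ^+ 2 in kM.
have K0 : 0 <= K by rewrite !mulr_ge0// ?exprn_ge0// addr_ge0// sqr_ge0.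
have w0 : 0 < k - G0 by lra.
have w1 : 0 < k - G1 by lra.
have wm : 0 < k - G by lra.
have shiftE g : 0 < k - g -> - cotD k (- g) = - k + (k ^+ 2 + 1) / (k - g).
  by move=> kg; rewrite /cotD; field; rewrite gt_eqF.
rewrite !shiftE//.
(* The crossed weights turn the mean of the reciprocals into [W / ((k - G0) * (k - G1))]; [W] times
   the arithmetic mean exceeds that denominator by [s * t * (G0 - G1) ^+ 2]. *)
set W := t * (k - G0) + s * (k - G1).
have WK : K <= W by rewrite /W; nra.
suff main : W / ((k - G0) * (k - G1)) <= (k - G)^-1.
  have WE : W / ((k - G0) * (k - G1)) = s * (k - G0)^-1 + t * (k - G1)^-1.
    by rewrite /W; field; rewrite !gt_eqF.
  rewrite WE in main.
  have k0 : 0 <= k ^+ 2 + 1 by rewrite addr_ge0 ?sqr_ge0.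
  have sk : s * k + t * k = k by rewrite -mulrDl st mul1r.
  by have := ler_wpM2l k0 main; lra.
rewrite ler_pdivrMr ?mulr_gt0// ler_pdivlMl//.
set p0 := x0 + y0 in p00 p0M; set p1 := x1 + y1 in p10 p1M.
have pmE : x + y = s * p0 + t * p1 by rewrite /x /y /p0 /p1; ring.
set V := (y0 * p1 - y1 * p0) ^+ 2 + (p0 - p1) ^+ 2.
have V0 : 0 <= V by rewrite addr_ge0// sqr_ge0.
have GE : G = s * G0 + t * G1 + s * t * (V / (p0 * p1 * (x + y))).
  have := quad_over_lin_gap y0 y1 st p00 p10.
  rewrite -pmE => /(_ pm0); rewrite -/V -/y /G /G0 /G1 !cotDE// -/p0 -/p1.
  by rewrite -mulrA /y; lra.
(* The numerator combines the two quantities whose squares make up [V]. *)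
have dGE : G0 - G1 =
    ((x1 - y0) * (y0 * p1 - y1 * p0) + (1 + y0 * x1) * (p0 - p1)) / (p0 * p1).
  rewrite /G0 /G1 /cotD -/p0 -/p1 /p0 /p1; field.
  by rewrite !gt_eqF.
have dG2 : (G0 - G1) ^+ 2 <= W * (V / (p0 * p1 * (x + y))).
  have pp : 0 < p0 * p1 by exact: mulr_gt0.
  have pm2 : x + y <= 2 * M.
    by move: xM yM; rewrite !ler_norml => /andP[_ ?] /andP[_ ?]; lra.
  have pp4 : 4 <= 9 * M ^+ 2 * (p0 * p1).
    have -> : 9 * M ^+ 2 * (p0 * p1) = (3 * M * p0) * (3 * M * p1) by ring.
    have -> : 4 = 2 * 2 :> R by ring.
    by apply: ler_pM.
  (* Cauchy-Schwarz, with the Lagrange identity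
     (x1 - y0)^2 + (1 + y0 x1)^2 = (1 + x1^2) (1 + y0^2). *)
  have E2 : ((x1 - y0) * (y0 * p1 - y1 * p0) + (1 + y0 * x1) * (p0 - p1)) ^+ 2
      <= (1 + M ^+ 2) ^+ 2 * V.
    have sqM z : `|z| <= M -> z ^+ 2 <= M ^+ 2.
      by move=> zM; rewrite -real_normK ?num_real// ler_sqr ?nnegrE.
    have xyM : (1 + x1 ^+ 2) * (1 + y0 ^+ 2) <= (1 + M ^+ 2) ^+ 2.
      by rewrite expr2; apply: ler_pM; rewrite ?addr_ge0 ?sqr_ge0// lerD2l sqM.
    apply: le_trans (ler_wpM2r V0 xyM); rewrite -subr_ge0.
    have -> : (1 + x1 ^+ 2) * (1 + y0 ^+ 2) * V
        - ((x1 - y0) * (y0 * p1 - y1 * p0) + (1 + y0 * x1) * (p0 - p1)) ^+ 2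
      = ((x1 - y0) * (p0 - p1) - (1 + y0 * x1) * (y0 * p1 - y1 * p0)) ^+ 2.
      by rewrite /V; ring.
    exact: sqr_ge0.
  have WM : (1 + M ^+ 2) ^+ 2 * (x + y) <= W * (p0 * p1).
    apply: (@le_trans _ _ (K * (p0 * p1))); last by rewrite ler_pM2r.
    have L0 : 0 <= (1 + M ^+ 2) ^+ 2 := sqr_ge0 _.
    apply: le_trans (ler_wpM2l L0 pm2) _.
    have := ler_wpM2l (mulr_ge0 M0 L0) pp4.
    by rewrite /K; set Q := p0 * p1; lra.
  rewrite dGE expr_div_n mulrA ler_pdivrMr ?exprn_gt0//.
  have -> : W * V / (p0 * p1 * (x + y)) * (p0 * p1) ^+ 2
      = W * (p0 * p1) * V / (x + y).
    by rewrite /p0 /p1; field; rewrite !gt_eqF.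
  rewrite ler_pdivlMr//; apply: le_trans (ler_wpM2r V0 WM).
  by rewrite [leRHS]mulrAC ler_pM2r.
have tE : t = 1 - s by lra.
have -> : (k - G0) * (k - G1) =
    W * (s * (k - G0) + t * (k - G1)) - s * t * (G0 - G1) ^+ 2.
  by rewrite /W tE; ring.
have := ler_wpM2l (mulr_ge0 s0 t0) dG2.
have -> : k - G =
    s * (k - G0) + t * (k - G1) - s * t * (V / (p0 * p1 * (x + y))).
  by rewrite GE tE; ring.
set Q := V / _; lra.
Qed.

(** * Convexity of the exponential of the arctangent *)

Lemma expR_atan_convex (R : realType) (A : R) (t : {i01 R}) (a b : R^o) :
  0 <= A -> - A / 2 <= a -> - A / 2 <= b ->
  expR (- (A * atan (conv t a b))) <=
  conv t (expR (- (A * atan a)) : R^o) (expR (- (A * atan b)) : R^o).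
Proof.
move=> A0; wlog ab : t a b / a <= b.
  move=> H ha hb; have [ab|/ltW ba] := leP a b; first exact: H.
  by rewrite convC [leRHS]convC; exact: H.
move=> ha hb.
pose f x : R := expR (- (A * atan x)).
have df (x : R) : is_derive x 1 f (- A * (1 + x ^+ 2)^-1 * f x).
  rewrite /f; apply: is_derive_eq.
  by rewrite /GRing.scale/=; ring.
have x2 (x : R) : 1 + x ^+ 2 != 0 by rewrite gt_eqF// ltr_pwDl// sqr_ge0.
have f'E : 'D_1 f = fun x => - A * (1 + x ^+ 2)^-1 * f x.
  by apply/funext => x; rewrite derive_val.
have ddf (x : R) : is_derive x 1 (fun x => - A * (1 + x ^+ 2)^-1 * f x)
   (A * (A + 2 * x) * (1 + x ^+ 2)^-2 * f x).
  have dinv : is_derive x 1 (fun x : R => (1 + x ^+ 2)^-1)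
      (- (1 + x ^+ 2)^-2 * (2 * x)).
    have dx2 : is_derive x 1 (fun x : R => 1 + x ^+ 2) (2 * x).
      by apply: is_derive_eq; rewrite /GRing.scale/=; ring.
    have := @is_deriveV R (fun x => 1 + x ^+ 2) x _ _ (x2 x) dx2.
    by move=> ?; apply: is_derive_eq; rewrite /GRing.scale.
  apply: is_derive_eq.
  by rewrite /GRing.scale/=; move: (f x) => fx; field; exact: x2.
(* The sign is that of [A + 2 * x], whence the threshold [- A / 2]. *)
have ddf_ge0 x : a < x < b -> 0 <= 'D_1 ('D_1 f) x.
  move=> /andP[ax xb]; rewrite f'E derive_val.
  have Ax : 0 <= A + 2 * x by lra.
  by rewrite !mulr_ge0 ?expR_ge0// invr_ge0 sqr_ge0.
have cf x : {for x, continuous f}.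
  exact/differentiable_continuous/derivable1_diffP.
have df1 x : derivable f x 1 by [].
have ddf1 x : derivable ('D_1 f) x 1 by rewrite f'E.
have H := @second_derivative_convex R f a b.
apply: (H ddf_ge0 _ _ _ _ t ab) => [||x _|x _].
- exact/cvg_at_left_filter/cf.
- exact/cvg_at_right_filter/cf.
- exact: df1.
- exact: ddf1.
Qed.

(** * The phase along a chord of the domain *)

Lemma shifted_cotDE (R : realType) (k x y : R) :
  0 < x + y -> cotD x y < k ->
  atan (- cotD k (- cotD x y)) = atan x + atan y - atan k.
Proof.
move=> xy0 Gk; have kG : 0 < k + - cotD x y by rewrite subr_gt0.
by have := atan_cotD xy0; have := atan_cotD kG; rewrite !atanN; lra.
Qed.

Lemma phase_recl2 (R : realType) (n : nat) (lam : 'rV[R]_n.+2) :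
  phase lam = atan (lam 0 ord0) + atan (lam 0 (lift ord0 ord0))
    + \sum_(i < n) atan (lam 0 (lift ord0 (lift ord0 i))).
Proof. by rewrite /phase big_ord_recl/= big_ord_recl/= addrA. Qed.

(** A third entry [z] exists: its angle leaves the first two a sum of at most [pi - alpha_3], whose
    cotangent is at least [- z >= - M]. *)
Lemma phase_domain_cotD (R : realType) (n : nat) (M : R) (lam : 'rV[R]_n.+3)
    (x := lam 0 ord0) (y := lam 0 (lift ord0 ord0)) :
  phase_domain M lam -> 0 < x + y /\ - M <= cotD x y.
Proof.
move=> [ph lM]; rewrite phase_recl2 big_ord_recl/= in ph.
rewrite -/x -/y in ph; set z := lam 0 _ in ph.
have zM : z <= M.
  by have := lM (lift ord0 (lift ord0 ord0)); rewrite ler_norml => /andP[].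
have sle : \sum_(i < n) atan (lam 0 (lift ord0 (lift ord0 (lift ord0 i))))
    <= n%:R * (pi / 2).
  rewrite -[n in n%:R]card_ord mulr_natl -sumr_const.
  by apply: ler_sum => i _; exact/ltW/atan_ltpi2.
have xyz : pi / 2 - atan z <= atan x + atan y.
  by move: ph sle; set S := \sum_(i < n) _; rewrite -!natr1; lra.
have xy0 : 0 < x + y by rewrite -atan_add_gt0; have := atan_ltpi2 z; lra.
split=> //; apply: le_trans (_ : - z <= _); first by rewrite lerN2.
rewrite leNgt; apply/negP => /lt_atan; rewrite atanN.
by have := atan_cotD xy0; lra.
Qed.

Lemma phase_chord (R : realType) (n : nat) (M s t : R) (u v : 'rV[R]_n.+3)
    (c := n.+1%:R * (pi / 2) + atan (slack M)) :
  0 <= s -> 0 <= t -> s + t = 1 -> phase_domain M u -> phase_domain M v ->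
  exists z0 z1 z, [/\ phase u = c + atan z0, phase v = c + atan z1,
    phase (s *: u + t *: v) = c + atan z
    & s * z0 + t * z1 <= z] /\ - slack M <= z0 /\ - slack M <= z1.
Proof.
move=> s0 t0 st uD vD.
have [pu gu] := phase_domain_cotD uD; have [pv gv] := phase_domain_cotD vD.
have [phu uM] := uD; have [phv vM] := vD.
have M0 : 0 <= M := le_trans (normr_ge0 _) (uM ord0).
have Mk : M / 2 < slack M.
  rewrite /slack (ger0_norm M0) -addrA ltr_pwDl// lerDl.
  by rewrite !mulr_ge0 ?exprn_ge0 ?addr_ge0 ?sqr_ge0.
set k := slack M in c Mk *.
set w := s *: u + t *: v.
have wE i : w 0 i = s * u 0 i + t * v 0 i by rewrite !mxE.
have wM i : `|w 0 i| <= M by rewrite wE conv_norm_le.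
have pw : 0 < w 0 ord0 + w 0 (lift ord0 ord0).
  by have := conv_gt0 s0 t0 st pu pv; rewrite !wE; lra.
have Hc := shifted_cotD_concave s0 t0 st (lexx k)
  (uM _) (vM _) (uM _) (vM _) pu pv gu gv.
rewrite -!wE in Hc.
have phaseE (q : 'rV[R]_n.+3) : (forall i, `|q 0 i| <= M) ->
    0 < q 0 ord0 + q 0 (lift ord0 ord0) ->
    atan (- cotD k (- cotD (q 0 ord0) (q 0 (lift ord0 ord0))))
    + \sum_(i < n.+1) (atan (q 0 (lift ord0 (lift ord0 i))) - pi / 2)
    = phase q - c.
  move=> qM pq; rewrite shifted_cotDE//; last first.
    exact: le_lt_trans (cotD_le (qM _) (qM _) pq) Mk.
  rewrite phase_recl2 sumrB sumr_const card_ord -mulr_natl /c.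
  by set S := \sum_(i < _) _; lra.
have k2 := atan_ltpi2 k.
have nat3E : n.+3%:R = n.+1%:R + 2 :> R by rewrite -natrD addn2.
(* The critical phase [n.+1%:R * (pi / 2)] is [c - atan k], so domain membership reads
   [atan z >= - atan k]. *)
have ge_k (q : 'rV[R]_n.+3) : phase_domain M q -> - atan k <= phase q - c.
  by move=> [+ _]; rewrite nat3E /c; lra.
have := @atan_chain_concave R n.+1 s t _ _ _
  (fun i => u 0 (lift ord0 (lift ord0 i)))
  (fun i => v 0 (lift ord0 (lift ord0 i))) s0 t0 st Hc.
rewrite (phaseE u)// (phaseE v)//.
have := ge_k _ uD; have := ge_k _ vD => kv ku.
case=> [||z0 [z1 [z [e0 e1 e zle]]]]; [lra|lra|].
have ew : phase w - c = atan z.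
  by rewrite -e -phaseE//; congr (_ + _); apply: eq_bigr => i _; rewrite wE.
have atan_le_cancel (a b : R) : atan a <= atan b -> a <= b.
  by apply: contraTT; rewrite -!ltNge => /lt_atan.
exists z0, z1, z; split; first by split=> //; lra.
by split; apply: atan_le_cancel; rewrite atanN; lra.
Qed.

Theorem lemma6p1 (R : realType) :
  exists A : nat -> R -> R,
    (forall n M, 0 < A n M) /\
    forall (n : nat) (r : R) (Theta : 'rV[R]_n -> R -> 'rV[R]_n -> R)
           (u : 'rV[R]_n -> R),
      (2 < n)%N -> 0 < r ->
      lagrangian_solution (@eball R n r) Theta u ->
      (hessian_norm (@eball R n r) u < +oo)%E ->
      let M := fine (hessian_norm (@eball R n r) u) in
      concave_on (@phase_domain R n M)
        (fun lam => - expR (- (A n M * phase lam))).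
Proof.
exists (fun _ M => 2 * slack M); split => [_ M|].
  by rewrite mulr_gt0 ?slack_gt0.
move=> [|[|[|n]]]// r Theta u _ _ _ _ M; move: M => {r Theta u} M.
have k0 := slack_gt0 M.
have nat3E : n.+3%:R = n.+1%:R + 2 :> R by rewrite -natrD addn2.
have tP (t : {i01 R}) :
    [/\ 0 <= t%:num, 0 <= 1 - t%:num & t%:num + (1 - t%:num) = 1].
  by split; rewrite ?subr_ge0 ?ge0 ?le1// subrKC.
split=> [x y t|t x y].
- rewrite !inE => xD yD; have [t0 t1 t01] := tP t.
  have [z0 [z1 [z [[_ _ e zle] [z0k z1k]]]]] := phase_chord t0 t1 t01 xD yD.
  have -> : conv t x y = t%:num *: x + (1 - t%:num) *: y by [].
  split.
  (* The mean of [z0] and [z1] is at least [- slack M], hence so is [z]. *)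
  + have : - atan (slack M) <= atan z by rewrite -atanN; apply: le_atan; nra.
    by rewrite e nat3E; lra.
  + by move=> i; rewrite !mxE conv_norm_le ?xD.2 ?yD.2.
- rewrite !inE => xD yD; have [t0 t1 t01] := tP t.
  have [z0 [z1 [z [[e0 e1 e zle] [z0k z1k]]]]] := phase_chord t0 t1 t01 xD yD.
  set c := _ + atan (slack M) in e0 e1 e.
  have eC : phase (conv t x y : 'rV[R]_n.+3) = c + atan z := e.
  have expRE w : expR (- (2 * slack M * (c + w))) =
      expR (- (2 * slack M * c)) * expR (- (2 * slack M * w)).
    by rewrite -expRD; congr expR; ring.
  rewrite !opprK e0 e1 eC convRE !expRE ![_ * (expR _ * _)]mulrCA -mulrDr.
  rewrite ler_pM2l ?expR_gt0//.
  have k2 : 0 <= 2 * slack M by lra.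
  apply: le_trans (expR_atan_convex t k2 _ _); [|lra|lra].
  by rewrite ler_expR lerN2 ler_pM2l ?mulr_gt0//; exact: le_atan.
Qed.
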